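(* Let $G$ be a finite simple graph on $n$ vertices. If $\delta(G)\geq \tilde\alpha(G)$, then $G$ is pancyclic, unless $G$ is the complete bipartite graph $K_{\frac{n}{2},\frac{n}{2}}$.
   Context: $\delta(G)$ denotes the minimum degree of $G$. The bipartite independence number $\tilde\alpha(G)$ is the minimal number $k$ such that there exist positive integers $a$ and $b$ with $a+b=k+1$ with the property that for any two disjoint sets $A,B\subseteq V(G)$ with $|A|=a$ and $|B|=b$, there is an edge of $G$ between $A$ and $B$. An $n$-vertex graph is pancyclic if it contains a cycle of length $\ell$ for every integer $\ell$ with $3\leq \ell\leq n$. *)

(* Defs.v *)
From mathcomp Require Import all_boot.
Set Implicit Arguments. Unset Strict Implicit. Unset Printing Implicit Defensive.

Section Graphs.
Variables (T : finType) (e : rel T).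

Definition simple_graph : Prop := symmetric e /\ irreflexive e.

(* degree and minimum degree delta(G) (for the empty vertex set: #|T| = 0) *)
Definition deg (x : T) : nat := #|[set y | e x y]|.
Definition min_deg : nat := \big[minn/#|T|]_(x : T) deg x.

Definition bip_prop (k : nat) : bool :=
  [exists a : 'I_k.+1,
     (0 < a) && (0 < k.+1 - a) &&
     [forall A : {set T}, forall B : {set T},
        [&& #|A| == a, #|B| == k.+1 - a & [disjoint A & B]] ==>
        [exists x in A, exists y in B, e x y]]].

Lemma bip_prop_exists : exists k, bip_prop k.
Proof.
exists #|T|.+1; apply/existsP; exists (Ordinal (ltnSn #|T|.+1)) => /=.
(* a = #|T|.+1, b = 1: no A of size a exists *)
rewrite subSnn /=.
apply/forallP => A; apply/forallP => B; apply/implyP => /and3P [/eqP hA _ _].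
by have := max_card A; rewrite hA ltnn.
Qed.

Definition bip_indep : nat := ex_minn bip_prop_exists.

Definition has_cycle (l : nat) : Prop :=
  exists s : seq T, [/\ size s = l, uniq s & cycle e s].

Definition pancyclic : Prop :=
  forall l, 3 <= l <= #|T| -> has_cycle l.

Definition is_balanced_complete_bipartite : Prop :=
  exists A : {set T}, #|A|.*2 = #|T| /\
    forall x y, e x y = ((x \in A) != (y \in A)).

End Graphs.

(* Main.v *)
Require Import Defs.
From mathcomp Require Import all_boot zify.
Set Implicit Arguments. Unset Strict Implicit. Unset Printing Implicit Defensive.

(** Let a + b - 1 = k <= delta(G), with a <= b, be such that no disjoint sets of
sizes a and b span no edge between them. If G has no triangle, every
neighbourhood is an independent set of size exactly k, and any two vertices
outside N(v) have at least b neighbours each in N(v), hence a common one, so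
they are not adjacent and G = K_{k,k}.

Otherwise grow a cycle z x ... y with chord xy, which gives cycles of two
consecutive lengths, starting from a triangle: each time at least two vertices
are missing, such a cycle with one or two more vertices is found. Suppose not.
For an outside vertex u, the successors D on the path x ... y of the neighbours
of u are independent and have no edge to u or to the outside neighbours of u.
If the outside had at least b vertices, the ends of the paths that rotations
make out of "triangle xyz plus tail" would have no outside neighbour, and there
are at least a of them. So the outside has fewer than b vertices and each has
more than a neighbours on the cycle; counting D then forces every outside
vertex to be adjacent to x and y but not to z, and the outside to be
independent. For outside u and w, some neighbour c of w lies between two
neighbours of u; replacing c by u on the cycle leaves the adjacent vertices c
and w outside, a contradiction. A last missing vertex is inserted by applying
the same counting to the successors of its neighbours on the whole cycle. *)

(** * Duplicate-free sequences and cardinalities *)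

Lemma uniq_countP (T : eqType) (s : seq T) :
  reflect (forall x, count_mem x s <= 1) (uniq s).
Proof.
apply: (iffP idP) => [us x | le1].
  by rewrite count_uniq_mem //; case: (x \in s).
apply: count_mem_uniq => x; move: (le1 x); rewrite -has_pred1 has_count.
by case: (count _ _) => [|[]].
Qed.

Lemma next_cat (T : eqType) (v d : T) s1 s2 :
  uniq (rcons s1 v ++ d :: s2) -> next (rcons s1 v ++ d :: s2) v = d.
Proof.
rewrite -cats1 -catA /= cat_uniq => /and3P[_ /norP[vs1 _] _].
rewrite next_nth mem_cat mem_head orbT.
case: s1 vs1 => [|h s1] /=; first by rewrite eqxx.
rewrite inE => /norP[nvh vs1]; rewrite eq_sym (negbTE nvh) nth_cat.
rewrite ltnNge (leq_trans _ (leqnSn _)) ?index_cat ?(negbTE vs1) /= ?eqxx ?addn0 //.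
by rewrite subSnn.
Qed.

Lemma next_inj (T : eqType) (s : seq T) : uniq s -> injective (next s).
Proof. by move=> us; apply: can_inj (prev_next us). Qed.

Lemma cat_cons_inj (T : eqType) (c : T) s1 s2 t1 t2 : uniq (s1 ++ c :: s2) ->
  s1 ++ c :: s2 = t1 ++ c :: t2 -> s1 = t1 /\ s2 = t2.
Proof.
have sz l1 l2 : uniq (l1 ++ c :: l2) -> size l1 = index c (l1 ++ c :: l2).
  rewrite cat_uniq /= => /and3P[_ /norP[cl _] _].
  by rewrite index_cat (negbTE cl) /= eqxx addn0.
move=> us est; have sst : size s1 = size t1.
  by rewrite (sz _ _ us) est -sz // -est.
by move/eqP: est; rewrite eqseq_cat // => /andP[/eqP -> /eqP[->]].
Qed.

Lemma subset_of_card (T : finType) (A : {set T}) n :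
  n <= #|A| -> exists2 B : {set T}, B \subset A & #|B| = n.
Proof.
move=> nA; exists [set:: take n (enum A)].
  by apply/subsetP => x; rewrite inE => /mem_take; rewrite mem_enum.
have ut : uniq (take n (enum A)) by rewrite take_uniq ?enum_uniq.
rewrite (eq_card (B := mem (take n (enum A)))); last by move=> x; rewrite inE.
by move/card_uniqP: ut => ->; rewrite size_takel // -cardE.
Qed.

Lemma card_notin (T : finType) (l : seq T) : uniq l -> #|[set v | v \notin l]| + size l = #|T|.
Proof.
move/card_uniqP <-; rewrite -(cardsE (mem l)) -(cardsC [set v in l]) addnC.
by congr (_ + _); apply: eq_card => v; rewrite !inE.
Qed.

(* Counting occurrences turns the duplicate-freeness of a rearranged sequence
   into linear arithmetic. *)
Ltac uniqc := match goal with H : is_true (uniq _) |- _ =>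
    move/uniq_countP in H; apply/uniq_countP; let a := fresh in intro a;
    generalize (H a); rewrite /= ?(count_cat, count_rev) /= ?(count_cat, count_rev) /=
      ?(count_cat, count_rev); clear; lia end.

(** * Walks, cutting them, and successor sets *)

Section Walks.
Variables (T : finType) (e : rel T).
Hypotheses (esym : symmetric e) (eirr : irreflexive e).

Definition walk x y (s : seq T) :=
  if s is h :: t then [&& h == x, last h t == y & path e h t] else false.

Lemma walk1 x : walk x x [:: x].
Proof. by rewrite /= !eqxx. Qed.

Lemma walk_cat x y s x' y' s' :
  walk x y s -> e y x' -> walk x' y' s' -> walk x y' (s ++ s').
Proof.
case: s => //= h t /and3P[-> /eqP ly pt] eyx'.
case: s' => //= h' t' /and3P[/eqP h'x' /eqP ly' pt'].
by rewrite last_cat /= ly' eqxx cat_path pt ly /= h'x' eyx' -h'x' pt'.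
Qed.

Lemma walk_cons v x y s : e v x -> walk x y s -> walk v y (v :: s).
Proof. by move=> evx; apply: walk_cat (walk1 v) evx. Qed.

Lemma walk_rev x y s : walk x y s -> walk y x (rev s).
Proof.
case: s => //= h t /and3P[/eqP <- /eqP <- pt].
rewrite lastI rev_rcons /= eqxx rev_path.
rewrite (eq_path (e' := e)) ?pt ?andbT; last by move=> a b; rewrite /= esym.
by case: t pt => //= a t _; rewrite rev_cons last_rcons.
Qed.

Lemma walk_head x y s : walk x y s -> x \in s.
Proof. by case: s => //= h t /and3P[/eqP ->]; rewrite mem_head. Qed.

Lemma walk_last x y s : walk x y s -> y \in s.
Proof. by case: s => //= h t /and3P[_ /eqP <-]; rewrite mem_last. Qed.

Lemma walk_headE x y s : walk x y s -> s = x :: behead s.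
Proof. by case: s => //= h t /and3P[/eqP ->]. Qed.

Lemma walk_loop x s : walk x x s -> uniq s -> s = [:: x].
Proof.
case: s => //= h t /and3P[/eqP -> lx _] /andP[xt _]; case: t lx xt => //= g t.
by move=> /eqP <-; rewrite mem_last.
Qed.

Lemma walk_lastE x y s : walk x y s -> exists s', s = rcons s' y.
Proof.
by case: s => //= h t /and3P[_ /eqP <- _]; exists (belast h t); rewrite -lastI.
Qed.

Lemma walk_belast x y s : walk x y s -> x != y ->
  exists2 s', s = rcons s' y & exists2 v, walk x v s' & e v y.
Proof.
case: s => //= h t /and3P[/eqP <- /eqP <- ].
case: (lastP t) => [|t' v]; rewrite ?eqxx // last_rcons rcons_path.
move=> /andP[pt' ev] _; exists (h :: t') => //.
by exists (last h t'); rewrite /= ?eqxx.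
Qed.

Lemma walk_cycle x y s : walk x y s -> e y x -> cycle e s.
Proof.
case: s => //= h t /and3P[/eqP -> /eqP ly pt] eyx.
by rewrite rcons_path pt ly.
Qed.

Lemma next_walk x v d y s1 s2 :
  uniq (s1 ++ s2) -> walk x v s1 -> walk d y s2 -> next (s1 ++ s2) v = d.
Proof.
move=> us /walk_lastE[s1' es1] /walk_headE es2; move: us.
by rewrite es1 es2; apply: next_cat.
Qed.

Lemma walk_split x y s v : walk x y s -> uniq s -> v \in s -> v != y ->
  exists s1 s2, [/\ s = s1 ++ s2, walk x v s1, walk (next s v) y s2
                 & e v (next s v)].
Proof.
case: s => // h t /and3P[/eqP hx /eqP ly]; rewrite {}hx in ly * => pt us vt vy.
have [t1 [t2 [et lt1]]] : exists t1 t2, t = t1 ++ t2 /\ last x t1 = v.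
  by case/splitPl: vt pt ly us => t1 t2 l1 *; exists t1, t2.
 case: t2 => [|d t2] in et *.
  by rewrite -ly et cats0 lt1 eqxx in vy.
move: pt ly us; rewrite et cat_path last_cat /= lt1 => /and3P[p1 evd p2] ly us.
have w1 : walk x v (x :: t1) by rewrite /= lt1 p1 !eqxx.
have w2 : walk d y (d :: t2) by rewrite /= ly p2 !eqxx.
have /= -> : next (x :: t1 ++ d :: t2) v = d.
  exact: (next_walk (s1 := x :: t1) us w1 w2).
by exists (x :: t1), (d :: t2).
Qed.

(** Rotations cut a path behind two neighbours of an outside vertex, and nothing tells which of the
    two comes first. *)
Lemma walk_split2 x y s v v' : walk x y s -> uniq s ->
    v \in s -> v' \in s -> v != y -> v' != y -> v != v' ->
  exists s1 m s2, s = s1 ++ m ++ s2 /\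
    ([/\ walk x v s1, walk (next s v) v' m & walk (next s v') y s2] \/
     [/\ walk x v' s1, walk (next s v') v m & walk (next s v) y s2]).
Proof.
move=> ws us vs v's vy v'y vv'.
have [s1 [s2 [es w1 w2 _]]] := walk_split ws us vs vy.
have /andP[us1 us2] : uniq s1 && uniq s2.
  by move: us; rewrite es cat_uniq => /and3P[-> _ ->].
move: v's; rewrite {1}es mem_cat => /orP[v's1 | v's2].
  have [|t1 [t2 [et w1' w2' _]]] := walk_split w1 us1 v's1; first by rewrite eq_sym.
  exists t1, t2, s2; rewrite catA -et; split=> //; right; split=> //.
  have w3 : walk (next s1 v') y (t2 ++ s2).
    move: w2 (w2'); case: (s2) => // h t; case: (t2) => //= h2 t2'.
    move=> /and3P[/eqP hx /eqP ly pt] /and3P[-> /eqP ly2 p2].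
    rewrite last_cat cat_path p2 ly2 /= ly pt eqxx hx andbT.
    have [? [? [_ _ _ //]]] := walk_split ws us vs vy.
  (* [v'] is not the last vertex of [s1], so [next] does not wrap around there and agrees with
     [next] on [s]. *)
  suff -> : next s v' = next s1 v' by [].
  by rewrite es {1}et -catA; apply: (next_walk _ w1' w3); rewrite catA -et -es.
have [t1 [t2 [et w1' w2' evn]]] := walk_split w2 us2 v's2 v'y.
exists s1, t1, t2; rewrite -et; split=> //; left; split=> //.
have [? [? [_ _ _ ev]]] := walk_split ws us vs vy.
suff -> : next s v' = next s2 v' by [].
rewrite {1}es {1}et catA; apply: (next_walk _ (walk_cat w1 ev w1') w2').
by rewrite -catA -et -es.
Qed.

Lemma rot_walk C v : cycle e C -> uniq C -> v \in C ->
  exists i, walk (next C v) v (rot i C).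
Proof.
move=> cC uC vC; have dC : next C v \in C by rewrite mem_next.
have [i C' eC] := rot_to dC; exists i.
have := cC; rewrite -(rot_cycle i) eC /= rcons_path => /andP[pC _].
rewrite eqxx pC andbT.
have uR : uniq (next C v :: C') by rewrite -eC rot_uniq.
(* The last vertex must be [v]: its successor wraps around to the head [next C v], and [next] is
   injective. *)
rewrite -(inj_eq (next_inj uR)) -[in X in _ == X]eC next_rot //.
rewrite next_nth mem_last index_last //; apply/eqP.
by rewrite nth_default.
Qed.

Definition nbrs u (s : seq T) := [set v in s | e u v].

(* [next] wraps around at the end [y] of [s], hence [y] is left out. *)
Definition shift s y u := next s @: (nbrs u s :\ y).

Lemma card_shift s y u : uniq s -> y \in s ->
  #|shift s y u| + e u y = #|nbrs u s|.
Proof.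
move=> us ys; rewrite card_imset; last exact: next_inj.
by rewrite addnC [RHS](cardsD1 y) !inE ys.
Qed.

Lemma shift_in s y u : shift s y u \subset [set v in s].
Proof.
by apply/subsetP => _ /imsetP[v vN ->]; move: vN; rewrite !inE mem_next => /and3P[].
Qed.

Lemma shift_split x y s u d : walk x y s -> uniq s -> d \in shift s y u ->
  exists v s1 s2, [/\ s = s1 ++ s2, walk x v s1, walk d y s2 & e u v].
Proof.
move=> ws us /imsetP[v]; rewrite !inE => /and3P[vy vs euv] ->.
have [s1 [s2 [es w1 w2 _]]] := walk_split ws us vs vy.
by exists v, s1, s2.
Qed.

Lemma shift_split2 x y s u d d' : walk x y s -> uniq s ->
    d \in shift s y u -> d' \in shift s y u -> d != d' ->
  exists v v' s1 m s2, [/\ s = s1 ++ m ++ s2, e u v, e u v', walk x v s1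
    & (walk d v' m /\ walk d' y s2) \/ (walk d' v' m /\ walk d y s2)].
Proof.
move=> ws us /imsetP[v]; rewrite !inE => /and3P[vy vs euv] ->.
move=> /imsetP[v']; rewrite !inE => /and3P[v'y v's euv'] -> nd.
have vv' : v != v' by apply: contraNneq nd => ->.
have [s1 [m [s2 [es [[]|[]]]]]] := walk_split2 ws us vs v's vy v'y vv'.
  by exists v, v', s1, m, s2; split=> //; left.
by exists v', v, s1, m, s2; split=> //; right.
Qed.

(* With the chord [x y], the cycle [z :: s] yields cycles of lengths [size s]
   and [(size s).+1]. *)
Definition tri z x y s := [/\ walk x y s, uniq (z :: s), e z x, e z y & e x y].

Lemma tri_rev z x y s : tri z x y s -> tri z y x (rev s).
Proof.
case=> ws us zx zy xy; split; rewrite // 1?esym //; first exact: walk_rev.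
by rewrite /= mem_rev rev_uniq.
Qed.

(** Gains of two are excluded too, as some detours use two outside vertices. Such a gain skips no
    cycle length, since a [tri] yields two consecutive lengths. *)
Definition tri_stuck (s : seq T) := forall z' x' y' s', tri z' x' y' s' ->
  size s < size s' <= (size s).+2 -> False.

Lemma stuck_rev s : tri_stuck s -> tri_stuck (rev s).
Proof. by move=> st z' x' y' s'; rewrite size_rev; apply: st. Qed.

Definition has_tri n := [exists z, exists x, exists y, exists t : n.-tuple T,
  [&& walk x y t, uniq (z :: t), e z x, e z y & e x y]].

Lemma has_triP n :
  reflect (exists z x y s, tri z x y s /\ size s = n) (has_tri n).
Proof.
apply: (iffP existsP) => [[z /existsP[x /existsP[y /existsP[t /and5P[*]]]]]|].
  by exists z, x, y, t; rewrite size_tuple.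
case=> z [x [y [s [[ws us zx zy xy] /eqP sn]]]]; exists z.
apply/existsP; exists x; apply/existsP; exists y; apply/existsP.
by exists (Tuple sn); apply/and5P.
Qed.

(** * Detours through outside vertices *)

Section Stuck.
Variables (z x y : T) (s : seq T).
Hypotheses (ts : tri z x y s) (stuck : tri_stuck s).

Let ws : walk x y s. Proof. by case: ts. Qed.
Let us : uniq s. Proof. by case: ts => _ /andP[]. Qed.
Let zs : uniq (z :: s). Proof. by case: ts. Qed.
Let zx : e z x. Proof. by case: ts. Qed.
Let zy : e z y. Proof. by case: ts. Qed.
Let xy : e x y. Proof. by case: ts. Qed.
Let xz : e x z. Proof. by rewrite esym. Qed.
Let yz : e y z. Proof. by rewrite esym. Qed.
Let yx : e y x. Proof. by rewrite esym. Qed.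

(** Otherwise [u] fits between a neighbour and its successor [d]. *)
Lemma shift_nadj u d : uniq [:: u, z & s] -> d \in shift s y u -> ~~ e u d.
Proof.
move=> ut /(shift_split ws us)[v [s1 [s2 [es w1 w2 uv]]]]; apply/negP => ud.
have w : walk x y (s1 ++ u :: s2).
  by apply: (walk_cat w1) (walk_cons ud w2); rewrite esym.
apply: (stuck (z' := z) (x' := x) (y' := y) (s' := s1 ++ u :: s2)); last first.
  by rewrite es !size_cat /=; clear; lia.
by split=> //; rewrite es in ut *; uniqc.
Qed.

(** Otherwise a rotation gives, up to exchanging [d] and [d'], the path x ... v u v' ... d d' ... y
    with its middle piece reversed. *)
Lemma shift_indep u d d' : uniq [:: u, z & s] ->
  d \in shift s y u -> d' \in shift s y u -> ~~ e d d'.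
Proof.
move=> ut dS d'S; have [-> | nd] := eqVneq d d'; first by rewrite eirr.
have [v [v' [s1 [m [s2 [es uv uv' w1 w2]]]]]] := shift_split2 ws us dS d'S nd.
apply/negP => dd'.
have w : walk x y (s1 ++ u :: rev m ++ s2).
  apply: (walk_cat w1 _ (walk_cat (walk1 u) uv' _)); first by rewrite esym.
  case: w2 => -[wm w2]; first exact: walk_cat (walk_rev wm) dd' w2.
  by apply: walk_cat (walk_rev wm) _ w2; rewrite esym.
apply: (stuck (z' := z) (x' := x) (y' := y) (s' := s1 ++ u :: rev m ++ s2)); last first.
  by rewrite es !size_cat /= size_cat size_rev; clear; lia.
by split=> //; rewrite es in ut; uniqc.
Qed.

Lemma shift_nadj2 u w d : uniq [:: w, u, z & s] -> e u w ->
  d \in shift s y u -> ~~ e w d.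
Proof.
move=> ut uw /(shift_split ws us)[v [s1 [s2 [es w1 w2 uv]]]]; apply/negP => wd.
have wk : walk x y (s1 ++ [:: u, w & s2]).
  by apply: (walk_cat w1) (walk_cons uw (walk_cons wd w2)); rewrite esym.
apply: (stuck (z' := z) (x' := x) (y' := y) (s' := s1 ++ [:: u, w & s2])); last first.
  by rewrite es !size_cat /=; clear; lia.
by split=> //; rewrite es in ut; uniqc.
Qed.

(** Otherwise [u] takes the role of [z], over the path z x ... y with chord zy. *)
Lemma ext_nadj_zy u : uniq [:: u, z & s] -> e u z -> ~~ e u y.
Proof.
move=> ut uz; apply/negP => uy.
apply: (stuck (z' := u) (x' := z) (y' := y) (s' := z :: s)); last by rewrite /=; clear; lia.
by split=> //; apply: walk_cons zx ws.
Qed.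

End Stuck.

(** * Neighbours inside and outside, and tails hanging off a triangle *)

Definition out u (l : seq T) := [set v | (v \notin l) && e u v].

Lemma deg_split u l : deg e u = #|nbrs u l| + #|out u l|.
Proof.
rewrite /deg -(cardsID [set v in l] [set v | e u v]); congr (_ + _).
  by apply: eq_card => v; rewrite !inE andbC.
by apply: eq_card => v; rewrite !inE.
Qed.

Lemma card_nbrs_cons u v l : v \notin l -> #|nbrs u (v :: l)| = e u v + #|nbrs u l|.
Proof.
move=> vl; rewrite (cardsD1 v) !inE eqxx /=; congr (_ + _).
apply: eq_card => w; rewrite !inE.
by case: eqVneq => // ->; rewrite (negbTE vl).
Qed.

Lemma nbrs_perm u l l' : perm_eq l l' -> nbrs u l = nbrs u l'.
Proof. by move=> p; apply/setP => v; rewrite !inE (perm_mem p). Qed.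

Lemma card_nbrs_size u l : #|nbrs u l| <= size l.
Proof.
apply: leq_trans (card_size l); apply: subset_leq_card.
by apply/subsetP => v; rewrite inE => /andP[].
Qed.

Lemma shift_sep z x y s u : tri z x y s -> tri_stuck s -> uniq [:: u, z & s] ->
  forall d w, d \in shift s y u -> w \in u |: out u (z :: s) ->
  (d != w) && ~~ e d w.
Proof.
move=> ts st ut d w dS.
have ds : d \in s by have := subsetP (shift_in s y u) _ dS; rewrite inE.
rewrite !inE => /orP[/eqP -> | /andP[wS uw]].
  rewrite esym (shift_nadj ts st ut dS) andbT.
  by apply: contraTneq ds => ->; move: ut; rewrite /= inE => /andP[/norP[]].
have -> : d != w by apply: contraNneq wS => <-; rewrite ds orbT.
rewrite esym (shift_nadj2 ts st _ uw dS) //.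
rewrite /= in ut *; rewrite ut andbT inE negb_or inE wS andbT.
by apply: contraTneq uw => ->; rewrite eirr.
Qed.

Lemma uniq_out2 w u (l : seq T) : uniq (w :: l) -> u \in out w l ->
  uniq [:: w, u & l].
Proof.
rewrite inE => ut /andP[ul wu]; move: ut; rewrite /= inE negb_or ul.
by case/andP=> -> ->; rewrite !andbT; apply: contraTneq wu => ->; rewrite eirr.
Qed.

(* The triangle [x y z] with a tail [t] from [x] to [f]: an outside path
   attached to [f] that returns to the triangle would give a longer [tri]. *)
Section LolliEnd.
Variables (z x y f : T) (s t : seq T).
Hypotheses (ts : tri z x y s) (stuck : tri_stuck s).
Hypotheses (wt : walk x f t) (st : perm_eq (y :: t) s).

Let zs : uniq (z :: s). Proof. by case: ts. Qed.
Let zx : e z x. Proof. by case: ts. Qed.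
Let zy : e z y. Proof. by case: ts. Qed.
Let xy : e x y. Proof. by case: ts. Qed.
Let xz : e x z. Proof. by rewrite esym. Qed.
Let yz : e y z. Proof. by rewrite esym. Qed.
Let yx : e y x. Proof. by rewrite esym. Qed.

Let uzyt (l : seq T) : uniq (l ++ z :: s) = uniq (l ++ [:: z, y & t]).
Proof.
by apply: perm_uniq; rewrite perm_cat2l perm_cons perm_sym.
Qed.

Let lolliF z' x' y' s' : tri z' x' y' s' ->
  (size t).+1 < size s' <= (size t).+3 -> False.
Proof.
by move=> t' lt; apply: (stuck t'); rewrite -(perm_size st).
Qed.

Lemma lolli_y w : uniq [:: w, z & s] -> e f w -> ~~ e w y.
Proof.
rewrite (uzyt [:: w]) => ut fw; apply/negP => wy.
apply: (lolliF (z' := z) (x' := x) (y' := y) (s' := t ++ [:: w; y])); last first.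
  by rewrite size_cat /=; clear; lia.
split=> //; last by uniqc.
exact: walk_cat wt fw (walk_cons wy (walk1 y)).
Qed.

(** The tail avoids both [y] and [z], so these two can exchange roles. *)
Lemma lolli_z w : uniq [:: w, z & s] -> e f w -> ~~ e w z.
Proof.
rewrite (uzyt [:: w]) => ut fw; apply/negP => wz.
apply: (lolliF (z' := y) (x' := x) (y' := z) (s' := t ++ [:: w; z])); last first.
  by rewrite size_cat /=; clear; lia.
split=> //; last by uniqc.
exact: walk_cat wt fw (walk_cons wz (walk1 z)).
Qed.

Lemma lolli_y2 w u : uniq [:: w, u, z & s] -> e f w -> e w u -> ~~ e u y.
Proof.
rewrite (uzyt [:: w; u]) => ut fw wu; apply/negP => uy.
apply: (lolliF (z' := z) (x' := x) (y' := y) (s' := t ++ [:: w; u; y])); last first.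
  by rewrite size_cat /=; clear; lia.
split=> //; last by uniqc.
exact: walk_cat wt fw (walk_cons wu (walk_cons uy (walk1 y))).
Qed.

Lemma lolli_z2 w u : uniq [:: w, u, z & s] -> e f w -> e w u -> ~~ e u z.
Proof.
rewrite (uzyt [:: w; u]) => ut fw wu; apply/negP => uz.
apply: (lolliF (z' := y) (x' := x) (y' := z) (s' := t ++ [:: w; u; z])); last first.
  by rewrite size_cat /=; clear; lia.
split=> //; last by uniqc.
exact: walk_cat wt fw (walk_cons wu (walk_cons uz (walk1 z))).
Qed.

Let ut : uniq t.
Proof. by move: zs; rewrite (uzyt [::]) /= => /and3P[]. Qed.

(** Read from [f] to [x], the tail has [d] right after a neighbour [c] of [y]; the path x ... d u w
    f ... c y would gain two vertices. *)
Lemma lolli_shift2 w u d : uniq [:: w, u, z & s] -> e f w -> e w u ->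
  d \in shift (rev t) x y -> ~~ e d u.
Proof.
rewrite (uzyt [:: w; u]) => ut2 fw wu.
have utr : uniq (rev t) by rewrite rev_uniq.
move=> /(shift_split (walk_rev wt) utr)[c [s1 [s2 [er w1 w2 yc]]]].
apply/negP => du.
have et : t = rev (s1 ++ s2) by rewrite -er revK.
have wk : walk x y (rev s2 ++ ([:: u, w & s1] ++ [:: y])).
  apply: (walk_cat (walk_rev w2) du); apply: walk_cat (walk1 y).
    by apply: walk_cons (walk_cons _ w1); rewrite esym.
  by rewrite esym.
have sz : size (rev s2 ++ [:: u, w & s1] ++ [:: y]) = (size t).+3.
  by rewrite et !(size_cat, size_rev) /= ?size_cat /=; clear; lia.
apply: (lolliF (z' := z) (And5 wk _ zx zy xy)); last by rewrite sz; clear; lia.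
by rewrite et in ut2; uniqc.
Qed.

Lemma lolli_shift v d : uniq [:: v, z & s] -> e v y ->
  d \in shift [:: y, z & t] f f -> ~~ e d v.
Proof.
rewrite (uzyt [:: v]) => uv vy.
have uyzt : uniq [:: y, z & t]. by uniqc.
have wyz : walk y f [:: y, z & t] by apply: walk_cons yz (walk_cons zx wt).
move=> /(shift_split wyz uyzt)[c [s1 [s2 [es w1 w2 fc]]]].
apply/negP => dv; have vd : e v d by rewrite esym.
(* The neighbour [c] of [f] before [d] is [y], [z] or on the tail. In the first two cases [v] sees
   both ends of the chord zy or xy; in the third, the path x ... c f ... d v y is used. *)
move: es w1; case: s1 => [//|h [|h' [|x' t1]]] /=.
- case=> <- es /and3P[_ /eqP yc _]; rewrite -es in w2.
  have dz : d = z by move/walk_headE: w2 => [].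
  rewrite -yc {}dz in fc vd w2.
  apply: (lolliF (z' := v) (x' := z) (y' := y) (s' := (z :: t) ++ [:: y])); last first.
    by rewrite size_cat /=; clear; lia.
  split=> //; last by uniqc.
  exact: walk_cat w2 fc (walk1 y).
- case=> <- <- es /and4P[_ /eqP zc _ _]; rewrite -es in w2.
  have dx : d = x by move/walk_headE: w2 (wt) => -> /= /and3P[/eqP].
  rewrite -zc {}dx in fc vd w2.
  apply: (lolliF (z' := v) (x' := x) (y' := y) (s' := t ++ [:: z; y])); last first.
    by rewrite size_cat /=; clear; lia.
  split=> //; last by uniqc.
  exact: walk_cat wt fc (walk_cons zy (walk1 y)).
case=> <- <- et /and5P[_ lc _ _ p1].
have w1 : walk x c (x' :: t1).
  by move: wt; rewrite et /= => /andP[-> _]; rewrite lc p1.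
apply: (lolliF (z' := z) (x' := x) (y' := y)
               (s' := (x' :: t1) ++ rev s2 ++ [:: v; y])); last first.
  by rewrite et !(size_cat, size_rev) /= ?(size_cat, size_rev) /=; clear; lia.
split=> //; last by rewrite et in uv; uniqc.
apply: walk_cat w1 _ (walk_cat (walk_rev w2) dv (walk_cons vy (walk1 y))).
by rewrite esym.
Qed.

End LolliEnd.

(** * Counting with the pair [a], [b] *)

Section NoHole.
Variables (a b : nat).
Hypotheses (a_gt0 : 0 < a) (le_ab : a <= b).
Hypothesis deg_ge : forall u, a + b <= (deg e u).+1.
Hypothesis nohole : forall A B : {set T}, a <= #|A| -> b <= #|B| ->
  (forall v w, v \in A -> w \in B -> (v != w) && ~~ e v w) -> False.

(** Take [a] vertices of [D] as one side; the rest of [D] joins [B] on the other side, which must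
    have fewer than [b] vertices. *)
Lemma nohole_split (D B : {set T}) :
    (forall v w, v \in D -> w \in D -> ~~ e v w) ->
    (forall v w, v \in D -> w \in B -> (v != w) && ~~ e v w) ->
  a <= #|D| -> #|D| + #|B| < a + b.
Proof.
move=> indD nDB aD; rewrite ltnNge; apply/negP => big.
have [A sAD cA] := subset_of_card aD.
have dDB : [disjoint D & B].
  by rewrite disjoints_subset; apply/subsetP => v vD; rewrite inE; apply/negP => vB;
     have := nDB _ _ vD vB; rewrite eqxx.
apply: (nohole (A := A) (B := (D :\: A) :|: B)); first by rewrite cA.
  rewrite cardsU (_ : (D :\: A) :&: B = set0) ?cards0 ?subn0; last first.
    apply/eqP; rewrite setI_eq0; apply: disjointWl dDB; exact: subsetDl.
  by rewrite cardsD (setIidPr sAD) cA; clear -big aD; lia.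
move=> v w vA; have vD := subsetP sAD _ vA.
rewrite !inE => /orP[/andP[wA wD] | wB]; last exact: nDB.
by rewrite indD // andbT; apply: contraNneq wA => <-.
Qed.

(** As [z] and [y] are not neighbours of [u], shifting loses nothing: the shifted set, [u] and the
    outside neighbours of [u] make up deg u + 1 vertices, too many for [nohole_split]. *)
Lemma stuck_low z x y s u : tri z x y s -> tri_stuck s -> uniq [:: u, z & s] ->
  ~~ e u z -> ~~ e u y -> #|nbrs u s| < a.
Proof.
move=> ts st ut uz uy; have [ws /andP[zs us] _ _ _] := ts.
rewrite ltnNge; apply/negP => big.
have cD := card_shift u us (walk_last ws).
rewrite (negbTE uy) addn0 in cD.
have := @nohole_split (shift s y u) (u |: out u (z :: s)).
move=> /(_ (fun d d' => shift_indep ts st ut (d := d) (d' := d'))).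
rewrite cD big cardsU1 inE eirr andbF /=; move=> H.
have {H} := H _ isT; have := deg_ge u.
rewrite (deg_split u (z :: s)) card_nbrs_cons // (negbTE uz) => dg.
move=> /(_ (shift_sep ts st ut)); clear -dg; lia.
Qed.

(** An outside neighbour [w] of [f] would have at least [b] outside neighbours. This forces the same
    for [y], whose outside neighbours then have no edge to a set of deg f vertices. *)
Lemma lolli_end_closed z x y f s t w :
    tri z x y s -> tri_stuck s -> walk x f t -> perm_eq (y :: t) s ->
  uniq [:: w, z & s] -> ~~ e f w.
Proof.
move=> ts st wt pst uw; apply/negP => fw.
have [ws zus zx zy xy] := ts.
have [zs us] : z \notin s /\ uniq s by apply/andP.
have uyt : uniq (y :: t) by rewrite (perm_uniq pst).
have [yt ut] := andP uyt.
have zyt : z \notin y :: t by rewrite (perm_mem pst).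
have [zny zt] : z != y /\ z \notin t by move: zyt; rewrite inE => /norP[].
have yx : e y x by rewrite esym.
have yz : e y z by rewrite esym.
have outw : b <= #|out w (z :: s)|.
  have := stuck_low ts st uw (lolli_z ts st wt pst uw fw) (lolli_y ts st wt pst uw fw).
  move: (deg_ge w); rewrite (deg_split w (z :: s)) card_nbrs_cons //.
  by rewrite (negbTE (lolli_z ts st wt pst uw fw)); clear; lia.
have outP v : v \in out w (z :: s) -> uniq [:: w, v, z & s] /\ e w v.
  by move=> vo; split; [exact: uniq_out2 | move: vo; rewrite inE => /andP[]].
(* [y] and [z] make up for the neighbours [x] and [z] of [y], which contribute no successor on the
   reversed tail. *)
pose AI := y |: (z |: shift (rev t) x y).
have cAI : #|AI| = #|nbrs y (z :: s)|.
  have shin v : v \in shift (rev t) x y -> v \in t.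
    by move=> /(subsetP (shift_in _ _ _)); rewrite inE mem_rev.
  have rt : perm_eq (rev t) t by rewrite perm_rev.
  rewrite !cardsU1 in_setU1 eq_sym (negbTE zny) (contraNF (shin z) zt).
  rewrite (contraNF (shin y) yt) card_nbrs_cons // yz -(nbrs_perm y pst).
  rewrite card_nbrs_cons // eirr -(nbrs_perm y rt).
  rewrite -(@card_shift (rev t) x y) ?rev_uniq ?mem_rev ?(walk_head wt) // yx.
  by rewrite ?in_setU1 /= !add1n addn1 .
have outy : b <= #|out y (z :: s)|.
  move: (deg_ge y); rewrite (deg_split y (z :: s)) -cAI.
  suff: #|AI| < a by clear; lia.
  rewrite ltnNge; apply/negP => aAI; apply: (nohole aAI outw) => v u vA.
  move=> uo; have [uwu wu] := outP _ uo.
  have uzs : u \notin z :: s by move: uo; rewrite inE => /andP[].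
  have vzs : v \in z :: s.
    move: vA; rewrite !inE -(perm_mem pst) inE; case/or3P=> [->|->|]; rewrite ?orbT //.
    by move=> /(subsetP (shift_in _ _ _)); rewrite inE mem_rev => ->; rewrite !orbT.
  have -> : v != u by apply: contraNneq uzs => <-.
  move: vA; rewrite !inE => /or3P[/eqP ->|/eqP ->|vA].
  - by rewrite esym (lolli_y2 ts st wt pst uwu fw wu).
  - by rewrite esym (lolli_z2 ts st wt pst uwu fw wu).
  by rewrite (lolli_shift2 ts st wt pst uwu fw wu vA).
have uyzt : uniq [:: y, z & t].
  by apply/and3P; split=> //; rewrite inE eq_sym negb_or zny.
have mem_yzt : z :: s =i [:: y, z & t].
  by move=> v; rewrite !inE -(perm_mem pst) inE orbCA.
have fyzt : f \in [:: y, z & t] by rewrite !inE (walk_last wt) !orbT.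
(* One element per neighbour of [f]: the inside ones are shifted, the outside ones kept. Leaving out
   the end [f] costs nothing, as [f] is not its own neighbour. *)
pose B := shift [:: y, z & t] f f :|: out f (z :: s).
have shin v : v \in shift [:: y, z & t] f f -> v \in z :: s.
  by move=> /(subsetP (shift_in _ _ _)); rewrite inE mem_yzt.
have cB : #|B| = deg e f.
  rewrite cardsU (_ : _ :&: _ = set0) ?cards0 ?subn0; last first.
    apply/setP => v; rewrite !in_setI in_set0; apply/andP => -[/shin vs].
    by rewrite inE vs.
  rewrite (deg_split f (z :: s)); congr (_ + _).
  have := @card_shift [:: y, z & t] f f uyzt fyzt; rewrite eirr addn0 => ->.
  by apply: eq_card => v; rewrite !inE -(perm_mem pst) inE orbCA.
have aB : a <= #|B|.
  by rewrite cB; move: (deg_ge f) (a_gt0) (le_ab); clear; lia.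
apply: (nohole aB outy) => d v dB; rewrite inE => /andP[vzs yv].
have vy : e v y by rewrite esym.
have uv : uniq [:: v, z & s] by rewrite /= in uw *; rewrite vzs; case/andP: uw.
move: dB; rewrite in_setU => /orP[dS|].
  rewrite (lolli_shift ts st wt pst uv vy dS) andbT.
  by apply: contraNneq vzs => <-; apply: shin.
rewrite inE => /andP[dzs fd].
have ud : uniq [:: d, z & s] by rewrite /= in uw *; rewrite dzs; case/andP: uw.
have dv : d != v.
  by apply: contraNneq (lolli_y ts st wt pst ud fd) => ->.
rewrite dv; apply/negP => edv.
suff: ~~ e v y by rewrite vy.
apply: (lolli_y2 ts st wt pst _ fd edv).
by rewrite /= inE negb_or dv dzs; exact: uv.
Qed.

Definition closed_in (l : seq T) :=
  [set v in l | [forall w, (w \notin l) ==> ~~ e v w]].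

Lemma closed_inP l v w : v \in closed_in l -> w \notin l -> ~~ e v w.
Proof. by rewrite inE => /andP[_ /forallP/(_ w)/implyP]. Qed.

Lemma lolli_end_in z x y f s t :
    tri z x y s -> tri_stuck s -> walk x f t -> perm_eq (y :: t) s ->
  f \in closed_in (z :: s).
Proof.
move=> ts st wt pst; rewrite !inE -(perm_mem pst) inE (walk_last wt) !orbT /=.
apply/forallP => w; apply/implyP => wzs.
apply: (lolli_end_closed ts st wt pst).
by have [_ us _ _ _] := ts; apply/andP.
Qed.

Lemma tri_belast z x y s : tri z x y s ->
  exists t f, [/\ s = rcons t y, walk x f t & e f y].
Proof.
case=> ws _ _ _ xy; have nxy : x != y by apply: contraTneq xy => ->; rewrite eirr.
by have [t -> [f wf fy]] := walk_belast ws nxy; exists t, f.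
Qed.

(** Otherwise fewer than [a] vertices of [z :: s] lack outside neighbours. All ends made by
    rotations are such vertices, and they are too many unless a = b = 2. *)
Lemma stuck_exterior_lt z x y s : tri z x y s -> tri_stuck s ->
  #|[set v | v \notin z :: s]| < b.
Proof.
move=> ts st; rewrite ltnNge; apply/negP => bR.
have [ws zus zx zy xy] := ts.
have [zs us] : z \notin s /\ uniq s by apply/andP.
have nxy : x != y by apply: contraTneq xy => ->; rewrite eirr.
have Ca : #|closed_in (z :: s)| < a.
  rewrite ltnNge; apply/negP => aC; apply: (nohole aC bR) => v w vC; rewrite inE => wR.
  rewrite (closed_inP vC wR) andbT.
  by apply: contraNneq wR => <-; move: vC; rewrite inE => /andP[].
have [t [f [es wt fy]]] := tri_belast ts.
have pst : perm_eq (y :: t) s by rewrite es perm_sym perm_rcons.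
have fC := lolli_end_in ts st wt pst.
have : uniq (rcons t y) by rewrite -es.
rewrite rcons_uniq => /andP[yt ut].
(* [y] and possibly [z] are neighbours of [f] off the tail, so rotating at [f] yields at least a + b
   - 3 ends, which suffices for b > 2. *)
have [c1 | c2] := leqP b 2; last first.
  have sub : shift t f f \subset closed_in (z :: s).
    apply/subsetP => d /(shift_split wt ut)[c [s1 [s2 [et w1 w2 fc]]]].
    apply: (lolli_end_in (x := x) (y := y) (t := s1 ++ rev s2) ts st).
      by apply: walk_cat w1 _ (walk_rev w2); rewrite esym.
    by apply: perm_trans pst; rewrite perm_cons et perm_cat2l perm_rev.
  move: (subset_leq_card sub) (card_shift f ut (walk_last wt)) (deg_ge f).
  rewrite eirr addn0 (deg_split f (z :: s)) card_nbrs_cons //.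
  rewrite -(nbrs_perm f pst) card_nbrs_cons // fy.
  rewrite (_ : out f (z :: s) = set0) ?cards0; last first.
    by apply/setP => v; rewrite !inE -in_cons; apply/negP => /andP[vR];
       rewrite (negbTE (closed_inP fC vR)).
  by move: Ca c2 (leq_b1 (e f z)); clear; lia.
(* Now only [f] lacks outside neighbours. The reversed path shows the same for the vertex after [x],
   hence [s] is x f y. *)
have [a2 b2] : a = 2 /\ b = 2.
  have : 0 < #|closed_in (z :: s)| by apply/card_gt0P; exists f.
  by move: Ca c1 le_ab; clear; lia.
have Cf v : v \in closed_in (z :: s) -> v = f.
  move=> vC; apply/eqP; apply/negPn/negP => vf.
  suff: 1 < #|closed_in (z :: s)| by move: Ca; rewrite a2; clear; lia.
  by apply/card_gt1P; exists v, f.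
have tsr := tri_rev ts.
have str := stuck_rev st.
have [t' [f' [es' wt' fx']]] := tri_belast tsr.
have pst' : perm_eq (x :: t') (rev s) by rewrite es' perm_sym perm_rcons.
have /Cf ff : f' \in closed_in (z :: s).
  have := lolli_end_in tsr str wt' pst'; rewrite !inE mem_rev.
  case/andP=> -> /forallP F; apply/forallP => w; have := F w.
  by rewrite !inE mem_rev.
rewrite {f'}ff in wt' fx' *.
have es2 : s = x :: rev t' by rewrite -[s]revK es' rev_rcons.
have s3 : s = [:: x; f; y].
  have wrt := walk_rev wt'; move: wt es us; rewrite es2.
  case: (rev t') wrt => //= h l /and3P[/eqP -> ly _].
  case: t {pst yt ut} => //= h' [|g t] /and3P[/eqP -> lf _].
    by case=> hy; move: fy; rewrite hy eirr.
  case=> _ -> /and3P[_ fl _]; case: t lf fl => //= g' t /eqP <-.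
  by rewrite -rcons_cons mem_rcons inE mem_last orbT.
(* [f] has degree at least 3 and all its neighbours are among [x], [y], [z]. *)
have fz : e f z.
  move: (deg_ge f); rewrite (deg_split f (z :: s)) card_nbrs_cons //.
  rewrite (_ : out f (z :: s) = set0) ?cards0; last first.
    by apply/setP => v; rewrite !inE -in_cons; apply/negP => /andP[vR];
       rewrite (negbTE (closed_inP fC vR)).
  case: (e f z) => //; rewrite a2 b2 s3.
  have fnx : f \notin [:: x; y].
    by move: us; rewrite s3 /= !inE !negb_or eq_sym; case/and3P=> /andP[-> _] ->.
  have pxf : perm_eq [:: x; f; y] [:: f; x; y].
    by apply/permP => p /=; rewrite addnCA.
  rewrite (nbrs_perm f pxf).
  by rewrite card_nbrs_cons // eirr; have /= := card_nbrs_size f [:: x; y]; clear; lia.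
have pzf : perm_eq (z :: s) [:: f, x, z & [:: y]].
  rewrite s3; by apply/permP => p /=; clear; lia.
(* Here [x], [y], [z], [f] form a clique, so [z] is an end as well. *)
have ts' : tri f x y [:: x; z; y].
  move: (fx') fy; rewrite s3 in ws *; split=> //.
    by rewrite /= !eqxx zy esym zx.
  by rewrite -(perm_uniq pzf); apply/andP.
have st' : tri_stuck [:: x; z; y] by move: st; rewrite s3.
have wz : walk x z [:: x; z] by rewrite /= !eqxx esym zx.
have pz : perm_eq [:: y; x; z] [:: x; z; y] by rewrite -(perm_rot 1).
have zC : z \in closed_in (z :: s).
  have := lolli_end_in ts' st' wz pz.
  rewrite inE => /andP[_ /forallP F]; rewrite inE mem_head /=.
  by apply/forallP => w; rewrite (perm_mem pzf).
have := Cf _ zC => zf; move: zs; rewrite s3 zf !inE eqxx orbT //.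
Qed.

(** * Adjacencies of the outside vertices *)

(** The outside has at most b - 1 vertices including [u], so at most b - 2 neighbours of [u] are
    there. *)
Lemma ext_many_nbrs z x y s u : tri z x y s -> tri_stuck s -> uniq [:: u, z & s] ->
  a < #|nbrs u (z :: s)|.
Proof.
move=> ts st ut; move: (stuck_exterior_lt ts st) (deg_ge u).
rewrite (deg_split u (z :: s)).
have uR : u \in [set v | v \notin z :: s] by rewrite inE; case/andP: ut.
have sub : out u (z :: s) \subset [set v | v \notin z :: s] :\ u.
  apply/subsetP => v; rewrite !inE => /andP[-> uv]; rewrite andbT.
  by apply: contraTneq uv => ->; rewrite eirr.
by move: (subset_leq_card sub); rewrite (cardsD1 u [set v | _]) uR; clear; lia.
Qed.

(** If [u] saw [z], it would see neither [x] nor [y]. In the count of [stuck_low], the successor [h]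
    of [x] then stands in for the lost neighbour [z]. *)
Lemma stuck_nadj_z z x y s u : tri z x y s -> tri_stuck s -> uniq [:: u, z & s] ->
  ~~ e u z.
Proof.
move=> ts st ut; apply/negP => uz; have [ws zus zx zy xy] := ts.
have [zs us] : z \notin s /\ uniq s by apply/andP.
have uy := ext_nadj_zy ts st ut uz.
have utr : uniq [:: u, z & rev s] by uniqc.
have str := stuck_rev st.
have ux := ext_nadj_zy (tri_rev ts) str utr uz.
have big := ext_many_nbrs ts st ut.
have cD := card_shift u us (walk_last ws); rewrite (negbTE uy) addn0 in cD.
have nxy : x != y by apply: contraTneq xy => ->; rewrite eirr.
have [s1 [s2 [es w1 w2 xh]]] := walk_split ws us (walk_head ws) nxy.
set h := next s x in w2 xh.
have hs : h \in s by rewrite mem_next (walk_head ws).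
(* With [c] the neighbour of [u] before [d], an edge dh gives the path z u c ... h d ... y, both of
   whose ends see [x]. *)
have hd d : d \in shift s y u -> (d != h) && ~~ e d h.
  move=> dS; have := dS; move=> /imsetP[c]; rewrite !inE => /and3P[cy cs uc] dc.
  have cx : c != x by apply: contraTneq uc => ->.
  have xc : x != c by rewrite eq_sym.
  have -> : d != h by rewrite dc (inj_eq (next_inj us)).
  apply/negP => edh.
  have [t1 [m [t2 [es' [|] []]]]] := walk_split2 ws us (walk_head ws) cs nxy cy xc;
    last first.
    move=> v1 v2 v3; have e1 := walk_headE v1.
    move: (us) (walk_last v2); rewrite es' e1 /= mem_cat negb_or mem_cat negb_or.
    by case/andP=> /and3P[_ /negP].
  move=> v1 v2 v3; rewrite -/h in v2; rewrite -dc in v3.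
  have et1 : t1 = [:: x].
    by apply: walk_loop v1 _; move: us; rewrite es' cat_uniq => /andP[].
  rewrite et1 in es'.
  have wn : walk z y ([:: z; u] ++ rev m ++ t2).
    apply: (walk_cat (walk_cons (y := u) _ (walk1 u)) uc); first by rewrite esym.
    by apply: walk_cat (walk_rev v2) _ v3; rewrite esym.
  apply: (st x z y ([:: z; u] ++ rev m ++ t2)); last first.
    by rewrite es' !(size_cat, size_rev) /= ?(size_cat, size_rev); clear; lia.
  by split; rewrite // 1?esym //; rewrite es' in ut; uniqc.
have aD : a <= #|shift s y u|.
  by rewrite cD; move: big; rewrite card_nbrs_cons // uz; clear; lia.
have hu : h \notin u |: out u (z :: s).
  rewrite !inE hs orbT /= orbF; apply: contraTneq hs => ->.
  by move: ut; rewrite /= inE => /andP[/norP[]].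
have := @nohole_split (shift s y u) (h |: (u |: out u (z :: s))).
move=> /(_ (fun d d' => shift_indep ts st ut (d := d) (d' := d'))) H.
have {H} := H _ aD; rewrite cD cardsU1 hu cardsU1 [in u \notin _]inE eirr andbF /=.
move: (deg_ge u); rewrite (deg_split u (z :: s)) card_nbrs_cons // uz => dg H.
suff {}/H : forall v w, v \in shift s y u -> w \in h |: (u |: out u (z :: s)) ->
    (v != w) && ~~ e v w by move: dg; clear; lia.
move=> d w dS; rewrite in_setU1 => /orP[/eqP -> | wB]; first exact: hd.
exact: shift_sep ts st ut _ _ dS wB.
Qed.

Lemma stuck_adj_y z x y s u : tri z x y s -> tri_stuck s -> uniq [:: u, z & s] ->
  e u y.
Proof.
move=> ts st ut; apply/negPn/negP => uy; have uz := stuck_nadj_z ts st ut.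
have := ext_many_nbrs ts st ut; rewrite card_nbrs_cons; last first.
  by case/and3P: ut.
by have := stuck_low ts st ut uz uy; rewrite (negbTE uz); clear; lia.
Qed.

(** Otherwise [w] sees both ends of the path x ... y u, which has the chord xu. *)
Lemma stuck_ext_indep z x y s u w : tri z x y s -> tri_stuck s ->
  uniq [:: u, z & s] -> uniq [:: w, z & s] -> ~~ e u w.
Proof.
move=> ts st ut wt; apply/negP => uw; have [ws zus zx zy xy] := ts.
have [zs us] : z \notin s /\ uniq s by apply/andP.
have utr : uniq [:: u, z & rev s] by uniqc.
have wtr : uniq [:: w, z & rev s] by uniqc.
have ux := stuck_adj_y (tri_rev ts) (stuck_rev st) utr.
have wx := stuck_adj_y (tri_rev ts) (stuck_rev st) wtr.
have uy := stuck_adj_y ts st ut.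
have yu : e y u by rewrite esym.
apply: (st w x u (s ++ [:: u])); last by rewrite size_cat /=; clear; lia.
split=> //; [exact: walk_cat ws yu (walk1 u) | | by rewrite esym..].
have : uniq [:: w, u, z & s].
  apply/andP; split=> //; rewrite inE negb_or; case/andP: wt => -> _; rewrite andbT.
  by apply: contraTneq uw => ->; rewrite eirr.
by move=> uwt; uniqc.
Qed.

(* Otherwise [D] together with [w] splits into two sets without edges between
   them, of sizes at least [a] and [b]. *)
Lemma indep_common (D : {set T}) w :
    (forall v v', v \in D -> v' \in D -> ~~ e v v') -> a + b <= #|D|.+1 ->
  w \notin D -> b <= #|[set d in D | e w d]|.
Proof.
move=> indD cD wD; have := cardsID [set d | e w d] D.
have -> : D :&: [set d | e w d] = [set d in D | e w d] by apply/setP => d; rewrite !inE.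
set M := D :\: _; set N := [set d in D | _] => cMN.
suff: #|M| < a by move: cMN cD; clear; lia.
rewrite ltnNge; apply/negP => aM.
have := @nohole_split M (w |: N); rewrite cardsU1 [in w \notin N]inE (negbTE wD) /=.
move=> H; have {H} : #|M| + (1 + #|N|) < a + b.
  apply: H => //.
    by move=> v v'; rewrite !inE => /andP[_ vD] /andP[_]; apply: indD.
  move=> v v'; rewrite !inE => /andP[wv vD] /orP[/eqP -> | /andP[v'D wv']].
    by rewrite esym wv andbT; apply: contraNneq wD => <-.
  by rewrite indD // andbT; apply: contraNneq wv => ->.
by move: cMN cD; clear; lia.
Qed.

Lemma indep_small (D : {set T}) :
  (forall v v', v \in D -> v' \in D -> ~~ e v v') -> #|D| < a + b.
Proof.
move=> indD; have [lt | aD] := ltnP #|D| a; first by rewrite ltn_addr.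
have := @nohole_split D set0 indD _ aD; rewrite cards0 addn0; apply.
by move=> v w _; rewrite inE.
Qed.

(** Disjoint sets would need 2b >= a + b elements of [N]. *)
Lemma card_meet (A B N : {set T}) : A \subset N -> B \subset N ->
  #|N| < a + b -> b <= #|A| -> b <= #|B| -> exists2 c, c \in A & c \in B.
Proof.
move=> AN BN cN bA bB.
have [c] : exists c, c \in A :&: B.
  apply/card_gt0P; have := cardsUI A B.
  have: #|A :|: B| <= #|N| by apply: subset_leq_card; rewrite subUset AN.
  by move: cN bA bB le_ab; clear; lia.
by rewrite inE => /andP[]; exists c.
Qed.

Lemma stuck_shift_indep z x y s u d d' : tri z x y s -> tri_stuck s ->
    uniq [:: u, z & s] ->
  d \in u |: shift s y u -> d' \in u |: shift s y u -> ~~ e d d'.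
Proof.
move=> ts st ut; rewrite !in_setU1 => /orP[/eqP -> | dS] /orP[/eqP -> | d'S].
- by rewrite eirr.
- by rewrite (shift_nadj ts st ut d'S).
- by rewrite esym; apply: (shift_nadj ts st ut dS).
by rewrite (shift_indep ts st ut dS d'S).
Qed.

Lemma notin_shift z s y u : uniq [:: u, z & s] -> u \notin shift s y u.
Proof.
move=> ut; apply/negP => /(subsetP (shift_in _ _ _)); rewrite inE => us'.
by move: ut; rewrite /= inE us' orbT.
Qed.

(** [u] itself replaces its neighbour [y], which contributes no successor; all neighbours of [u] lie
    on [s]. *)
Lemma stuck_shift_card z x y s u : tri z x y s -> tri_stuck s ->
  uniq [:: u, z & s] -> #|u |: shift s y u| = deg e u.
Proof.
move=> ts st ut; have [ws zus _ _ _] := ts.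
have us : uniq s by case/andP: zus.
rewrite cardsU1 (notin_shift _ ut) addnC.
have := card_shift u us (walk_last ws); rewrite (stuck_adj_y ts st ut) => ->.
rewrite (deg_split u (z :: s)) card_nbrs_cons; last by case/andP: zus.
rewrite (negbTE (stuck_nadj_z ts st ut)) (_ : out u _ = set0) ?cards0 ?addn0 //.
apply/setP => v; rewrite !inE -in_cons; apply/negP => /andP[vzs].
by apply/negP; apply: stuck_ext_indep ts st ut _; apply/andP.
Qed.

Lemma stuck_near z x y s u w : tri z x y s -> tri_stuck s ->
    uniq [:: u, z & s] -> uniq [:: w, z & s] -> u != w ->
  b <= #|[set d in u |: shift s y u | e w d]|.
Proof.
move=> ts st ut wt uw; apply: indep_common.
- by move=> d d'; apply: stuck_shift_indep ts st ut.
- by rewrite (stuck_shift_card ts st ut) deg_ge.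
rewrite in_setU1 eq_sym (negbTE uw) /=; apply/negP => /(subsetP (shift_in _ _ _)).
by rewrite inE => ws'; move: wt; rewrite /= inE ws' orbT.
Qed.

(** [w] has [b] neighbours among the successors of neighbours of [u] and, on the reversed path, [b]
    among the predecessors. As deg w < a + b, some [c] is both. *)
Lemma stuck_ext_le1 z x y s u w : tri z x y s -> tri_stuck s ->
  uniq [:: u, z & s] -> uniq [:: w, z & s] -> u = w.
Proof.
move=> ts st ut wt; apply/eqP/negPn/negP => uw; have [ws zus zx zy xy] := ts.
have us : uniq s by case/andP: zus.
have usr : uniq (rev s) by rewrite rev_uniq.
have utr : uniq [:: u, z & rev s] by uniqc.
have wtr : uniq [:: w, z & rev s] by uniqc.
have h1 := stuck_near ts st ut wt uw.
have h2 := stuck_near (tri_rev ts) (stuck_rev st) utr wtr uw.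
have nwu : ~~ e w u by apply: stuck_ext_indep ts st wt ut.
have dw : #|[set d | e w d]| < a + b.
  rewrite -/(deg e w) -(stuck_shift_card ts st wt); apply: indep_small => d d'.
  exact: stuck_shift_indep ts st wt.
have sub (D : {set T}) : [set d in D | e w d] \subset [set d | e w d].
  by apply/subsetP => d; rewrite !inE => /andP[].
have [c] := card_meet (sub _) (sub _) dw h1 h2.
rewrite !inE => /andP[+ wc] /andP[+ _].
have /negbTE -> : c != u by apply: contraTneq wc => ->.
move=> /(shift_split ws us)[p [s1 [s2 [es w1 w2 up]]]].
move=> /(shift_split (walk_rev ws) usr)[q [t1 [t2 [er v1 v2 uq]]]].
have [r2 e2] := walk_lastE (walk_rev v2).
have e3 := walk_headE w2.
(* [c] occurs once, so both cuts of [s] at [c] agree and [u] sees the vertices on either side of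
   [c]. *)
have est : s1 ++ c :: behead s2 = r2 ++ c :: rev t1.
  by rewrite -e3 -es -[s]revK er rev_cat e2 cat_rcons.
have us1 : uniq (s1 ++ c :: behead s2) by rewrite -e3 -es.
have [_ e4] := cat_cons_inj us1 est.
(* Swapping [u] for [c] leaves [c] and [w] outside, although they are adjacent. *)
pose s' := s1 ++ u :: rev t1.
have es3 : s = s1 ++ c :: rev t1 by rewrite es e3 e4.
have ts' : tri z x y s'.
  split=> //; last by rewrite es3 in ut; uniqc.
  by apply: (walk_cat w1) (walk_cons uq (walk_rev v1)); rewrite esym.
have st' : tri_stuck s'.
  by move=> z' x' y' s0; rewrite (_ : size s' = size s); [apply: st | rewrite es3 !size_cat].
have ct : uniq [:: c, z & s'] by rewrite es3 in ut; uniqc.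
have wt' : uniq [:: w, z & s'].
  have uwt : uniq [:: w, u, z & s].
    apply/andP; split=> //; rewrite inE negb_or eq_sym uw /=; by case/andP: wt.
  by rewrite es3 in uwt; uniqc.
by move: (stuck_ext_indep ts' st' wt' ct); rewrite wc.
Qed.

(** * Growing cycles and inserting the last vertex *)

Lemma has_tri_step z x y s : tri z x y s -> (size s).+2 < #|T| ->
  has_tri (size s).+1 || has_tri (size s).+2.
Proof.
move=> ts lt; have [ws zus _ _ _] := ts; apply/negPn/negP; rewrite negb_or.
case/andP=> n1 n2; have st : tri_stuck s.
  move=> z' x' y' s' ts' /andP[le1 le2].
  have [e1|e2] : size s' = (size s).+1 \/ size s' = (size s).+2.
    by move: le1 le2; clear; lia.
  - by case/has_triP: n1; exists z', x', y', s'.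
  by case/has_triP: n2; exists z', x', y', s'.
have : 1 < #|[set v | v \notin z :: s]|.
  by have := card_notin zus; rewrite [size _]/=; move: lt; clear; lia.
case/card_gt1P=> u [w []]; rewrite !inE -!in_cons => uR wR.
by apply/negP/negPn/eqP; apply: stuck_ext_le1 ts st _ _; apply/andP.
Qed.

(** [u] and the successors of its neighbours are deg u + 1 >= a + b vertices, hence not independent.
    An edge among them inserts [u] directly or after a rotation. *)
Lemma cycle_insert C u : cycle e C -> uniq (u :: C) -> out u C = set0 ->
  has_cycle e (size C).+1.
Proof.
move=> cC uuC outC; have [uC Cu] : u \notin C /\ uniq C by apply/andP.
pose D := next C @: nbrs u C.
have cD : #|D| = deg e u.
  by rewrite card_imset; [rewrite (deg_split u C) outC cards0 addn0 | apply: next_inj].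
have uD : u \notin D.
  by apply: contra uC => /imsetP[v]; rewrite inE => /andP[vC _] ->; rewrite mem_next.
have insert1 v : v \in C -> e u v -> e u (next C v) -> has_cycle e (size C).+1.
  move=> vC uv ud; have [i w] := rot_walk cC Cu vC.
  exists (u :: rot i C); rewrite /= size_rot mem_rot rot_uniq uC Cu; split=> //.
  by apply: (walk_cycle (walk_cons ud w)); rewrite esym.
have insert2 v v' : v \in C -> e u v -> v' \in C -> e u v' ->
    e (next C v) (next C v') -> has_cycle e (size C).+1.
  move=> vC uv v'C uv' dd'; have [i w] := rot_walk cC Cu vC.
  have nv : v' != v by apply: contraTneq dd' => ->; rewrite eirr.
  have uR : uniq (rot i C) by rewrite rot_uniq.
  have v'R : v' \in rot i C by rewrite mem_rot.
  have [C1 [C2 [eC w1 w2 _]]] := walk_split w uR v'R nv.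
  rewrite next_rot // in w2.
  have uuR : uniq (u :: C1 ++ C2) by rewrite -eC /= mem_rot rot_uniq.
  (* With [d], [d'] the successors of [v], [v'], this is the cycle u v' ... d d' ... v. *)
  exists (u :: rev C1 ++ C2); split.
  - by rewrite -(size_rot i C) eC /= !size_cat size_rev.
  - by uniqc.
  apply: (walk_cycle (x := u) (y := v)); last by rewrite esym.
  exact: walk_cons uv' (walk_cat (walk_rev w1) dd' w2).
have [/existsP[d /andP[dX /existsP[d' /andP[d'X dd']]]] | none] :=
  boolP [exists d in u |: D, exists d' in u |: D, e d d'].
  move: dX d'X dd'; rewrite !in_setU1.
  case/orP=> [/eqP -> | /imsetP[v + ->]] /orP[/eqP -> | /imsetP[v' + ->]]; rewrite ?eirr //.
  - by rewrite inE => /andP[v'C uv']; apply: insert1.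
  - by rewrite inE [e (next _ _) u]esym => /andP[vC uv]; apply: insert1.
  by rewrite !inE => /andP[vC uv] /andP[v'C uv']; apply: insert2.
have : #|u |: D| < a + b.
  apply: indep_small => d d' dX d'X; apply: contra none => dd'.
  by apply/existsP; exists d; rewrite dX; apply/existsP; exists d'; rewrite d'X.
by rewrite cardsU1 uD cD add1n ltnNge deg_ge.
Qed.

(** * Triangle-free graphs *)

Lemma tri_free_balanced (r : T) :
  (forall v u w, e v u -> e v w -> ~~ e u w) -> is_balanced_complete_bipartite e.
Proof.
move=> tf; pose N v := [set w | e v w].
have indN v : forall u w, u \in N v -> w \in N v -> ~~ e u w.
  by move=> u w; rewrite !inE; apply: tf.
have degE v : (deg e v).+1 = a + b.
  by apply/eqP; rewrite eqn_leq deg_ge andbT; apply: indep_small (indN v).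
have near w : w \notin N r -> b <= #|[set d in N r | e w d]|.
  by apply: indep_common (indN r) _; apply: deg_ge.
have subN w : [set d in N r | e w d] \subset N r.
  by apply/subsetP => d; rewrite inE => /andP[].
have indW : forall u w, u \in ~: N r -> w \in ~: N r -> ~~ e u w.
  move=> u w; rewrite !in_setC => /near bu /near bw.
  have [|c] := card_meet (subN u) (subN w) _ bu bw; first by rewrite -(degE r).
  by rewrite !inE => /andP[_ uc] /andP[_ wc]; apply: (tf c); rewrite esym.
have cW := indep_small indW.
(* The inclusion holds as [N r] is independent. The complement is independent as well, so it has at
   most a + b - 1 = deg v vertices. *)
have WE v : v \in N r -> N v = ~: N r.
  move=> vN; apply/eqP; rewrite eqEcard; apply/andP; split.
    by apply/subsetP => w wv; rewrite in_setC; apply: contraTN wv => wN;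
       rewrite inE (negbTE (indN r v w vN wN)).
  by rewrite -ltnS -/(deg e v) degE.
have [v vN] : exists v, v \in N r.
  by apply/card_gt0P; rewrite -/(deg e r); move: (degE r) a_gt0 le_ab; clear; lia.
exists (N r); split.
  rewrite -(cardsC (N r)) -(WE v vN) -addnn; congr (_ + _); apply: succn_inj.
  exact: etrans (degE r) (Logic.eq_sym (degE v)).
have adj x y : x \in N r -> y \notin N r -> e x y.
  by move=> xN yN; have: y \in N x; [rewrite WE // in_setC | rewrite inE].
move=> x y; case: (boolP (x \in N r)) => xN; case: (boolP (y \in N r)) => yN /=.
- by apply/negbTE/(indN r).
- exact: adj.
- by rewrite esym; apply: adj.
by apply/negbTE/indW; rewrite in_setC.
Qed.

(** * Pancyclicity from a triangle *)

Lemma tri_pancyclic z x y : e z x -> e z y -> e x y -> pancyclic e.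
Proof.
move=> zx zy xy.
have tri_cycles n : has_tri n -> has_cycle e n /\ has_cycle e n.+1.
  case/has_triP=> z' [x' [y' [s [[ws us zx' zy' xy'] <-]]]]; split.
    exists s; split=> //; first by case/andP: us.
    by apply: walk_cycle ws _; rewrite esym.
  exists (z' :: s); split=> //.
  by apply: walk_cycle (walk_cons zx' ws) _; rewrite esym.
(* [has_tri] at n - 1 or at n gives a cycle of length n = 3 + m, and this disjunction survives gains
   of one or two. The last alternative is the Hamilton cycle made by [cycle_insert]. *)
have main m : 3 + m <= #|T| ->
    has_tri (3 + m).-1 || has_tri (3 + m) \/ (3 + m = #|T| /\ has_cycle e (3 + m)).
  elim: m => [_ | m IHm lt].
    left; apply/orP; left; apply/has_triP; exists z, x, y, [:: x; y].
    split=> //; split=> //; first by rewrite /= !eqxx xy.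
    have ne u v : e u v -> u != v by apply: contraTneq => ->; rewrite eirr.
    by rewrite /= !inE negb_or !ne.
  have [|/orP[]| [E _]] := IHm; first by apply: leq_trans lt; rewrite leq_add2l.
  - case/has_triP=> z' [x' [y' [s [ts sz]]]].
    move: lt; rewrite addnS leq_eqVlt => /orP[/eqP E | lt]; last first.
      left; have := has_tri_step ts; rewrite sz addSn /= !addSn; apply.
      by rewrite -!addSn.
    right; split=> //; have [ws us zx' zy' xy'] := ts.
    have [u uR] : exists u, u \notin z' :: s.
      have : 0 < #|[set v | v \notin z' :: s]|.
        by have := card_notin us; rewrite [size _]/=; move: E sz; clear; lia.
      by case/card_gt0P=> u; rewrite inE; exists u.
    have uus : uniq (u :: z' :: s) by apply/andP.
    have := cycle_insert (C := z' :: s) (u := u); rewrite /= sz; apply=> //.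
      by apply: walk_cycle (walk_cons zx' ws) _; rewrite esym.
    have full : [:: u, z' & s] =i T.
      have : #|[:: u, z' & s]| = #|T|.
        by move/card_uniqP: uus => -> /=; rewrite sz -E.
      by move=> c; apply/(subset_cardP c)/subset_predT.
    apply/setP => v; rewrite !inE -in_cons; apply/negP => /andP[vzs uv].
    have := full v; rewrite in_cons (negbTE vzs) orbF inE => /eqP vu.
    by rewrite vu eirr in uv.
  - by move=> t; left; rewrite addnS /= t.
  by move: lt; rewrite -E addnS ltnn.
move=> l /andP[l3 lT]; have := main (l - 3); rewrite subnKC // => /(_ lT).
case=> [/orP[] /tri_cycles[] | []] //.
by rewrite prednK //; apply: leq_trans l3.
Qed.

End NoHole.
End Walks.

(** * Unfolding the invariants, and the conclusion *)

(** Larger sets are shrunk to the exact sizes in [bip_prop], and [v != w] encodes disjointness. *)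
Lemma bip_indepP (T : finType) (e : rel T) : exists a b,
  [/\ 0 < a, 0 < b, a + b = (bip_indep e).+1 & forall A B : {set T},
     a <= #|A| -> b <= #|B| ->
     (forall v w, v \in A -> w \in B -> (v != w) && ~~ e v w) -> False].
Proof.
rewrite /bip_indep; case: ex_minnP => k /existsP[a /andP[/andP[a0 b0] /forallP F]] _.
exists a, (k.+1 - a); split=> // [|A B aA bB sep].
  by rewrite subnKC // ltnW.
have [A' sA cA] := subset_of_card aA; have [B' sB cB] := subset_of_card bB.
have /forallP/(_ B')/implyP := F A'; rewrite cA cB !eqxx /=.
have -> : [disjoint A' & B'].
  rewrite disjoints_subset; apply/subsetP => v vA; rewrite in_setC; apply/negP => vB.
  by have := sep v v (subsetP sA _ vA) (subsetP sB _ vB); rewrite eqxx.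
case/(_ isT)/existsP=> v /andP[vA /existsP[w /andP[wB evw]]].
by have := sep v w (subsetP sA _ vA) (subsetP sB _ wB); rewrite evw andbF.
Qed.

Lemma min_deg_le (T : finType) (e : rel T) v : min_deg e <= deg e v.
Proof.
rewrite /min_deg; have := mem_index_enum v; elim: (index_enum T) => //= w l IHl.
by rewrite inE big_cons geq_min => /orP[/eqP <- | /IHl ->]; rewrite ?leqnn ?orbT.
Qed.

Theorem theorem1p2 (T : finType) (e : rel T) :
  simple_graph e ->
  bip_indep e <= min_deg e ->
  pancyclic e \/ is_balanced_complete_bipartite e.
Proof.
case=> esym eirr le_min.
have [a0 [b0 [a0_gt0 b0_gt0 Eab hole]]] := bip_indepP e.
have [a [b [a_gt0 le_ab sum_ab nohole]]] : exists a b,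
    [/\ 0 < a, a <= b, a + b = (bip_indep e).+1 & forall A B : {set T},
      a <= #|A| -> b <= #|B| ->
      (forall v w, v \in A -> w \in B -> (v != w) && ~~ e v w) -> False].
  case: (leqP a0 b0) => [le | /ltnW le]; first by exists a0, b0.
  exists b0, a0; rewrite addnC; split=> // A B bA aB sep.
  by apply: (hole B A) => // v w vB wA; rewrite eq_sym esym sep.
have deg_ge u : a + b <= (deg e u).+1.
  by rewrite sum_ab ltnS (leq_trans le_min) // min_deg_le.
have [/existsP[z /existsP[x /existsP[y /and3P[zx zy xy]]]] | free] :=
  boolP [exists z, exists x, exists y, [&& e z x, e z y & e x y]].
  by left; apply: (tri_pancyclic esym eirr a_gt0 le_ab deg_ge nohole zx zy xy).
(* A root for the neighbourhood argument is needed; without vertices there is no cycle length to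
   realise. *)
have [r _ | T0] := pickP (pred_of_simpl (@predT T)).
  right; apply: (tri_free_balanced esym a_gt0 le_ab deg_ge nohole r).
  move=> v u w vu vw; apply: contra free => uw.
  by apply/existsP; exists v; apply/existsP; exists u; apply/existsP; exists w; apply/and3P.
left=> l /andP[l3]; rewrite eq_card0 ?leqn0; first by case: l l3.
by move=> v; have := T0 v.
Qed.
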